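(* Let $q=q(n)$ be a sequence of positive integers such that $q=o\left(\frac{n}{\ln n}\right)$ as $n\to\infty$. Then there are functions $\varepsilon_1(n),\varepsilon_2(n)\to 0$ (as $n\to\infty$) such that for every $n\ge 2$, in the Waiter-Client game on the edges of $K_n$ with bias $q=q(n)$: (i) Waiter has a strategy which forces Client's graph at the end of the game to have a vertex of degree at least $(1+\varepsilon_1(n))\frac{n}{q+1}$; (ii) Client has a strategy which ensures that at the end of the game all vertices of his graph have degree at most $(1+\varepsilon_2(n))\frac{n}{q+1}$.
   Context: The Waiter-Client game on the edges of $K_n$ with bias $q$ is a two-player perfect information game. In each round Waiter offers Client $q+1$ edges of $K_n$ that have not been previously offered; Client claims one of them and Waiter claims the remaining $q$. When fewer than $q+1$ not previously offered edges remain, Waiter claims all of them and the game ends. Client's graph is the graph on $V(K_n)$ formed by the edges claimed by Client. *)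

(* Defs.v *)
From mathcomp Require Import all_boot.

Set Implicit Arguments.
Unset Strict Implicit.
Unset Printing Implicit Defensive.

Section WaiterClient.

Variables (n q : nat).

Definition edge := {e : {set 'I_n} | #|e| == 2}.

(* A round is (set of edges offered by Waiter, edge claimed by Client);
   histories list the most recent round first. *)
Definition round := ({set edge} * edge)%type.
Definition history := seq round.

Definition offered (h : history) : {set edge} := \bigcup_(r <- h) r.1.
Definition unoffered (h : history) : {set edge} := ~: offered h.

Definition client_graph (h : history) : {set edge} :=
  [set e | e \in [seq r.2 | r <- h]].

Definition degree (G : {set edge}) (v : 'I_n) : nat :=
  #|[set e in G | v \in val e]|.

Definition waiter_strategy := history -> {set edge}.
Definition client_strategy := history -> {set edge} -> edge.

Definition legal_offer (h : history) (A : {set edge}) : bool :=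
  (#|A| == q.+1) && (A \subset unoffered h).

(* Rules are imposed at every history at which the player has to move. As each
   such history admits a legal move, this only fixes the strategy at positions
   that do not arise in actual play and loses no generality. *)
Definition legal_waiter (W : waiter_strategy) : Prop :=
  forall h, q < #|unoffered h| -> legal_offer h (W h).
Definition legal_client (C : client_strategy) : Prop :=
  forall h A, legal_offer h A -> C h A \in A.

(* Once at most q unoffered edges remain, Waiter takes them all: Client's graph
   is final and the history no longer changes. *)
Fixpoint play (W : waiter_strategy) (C : client_strategy) (k : nat) : history :=
  if k is k'.+1 then
    let h := play W C k' in
    if q < #|unoffered h| then (W h, C h (W h)) :: h else h
  else [::].

(* Every round uses up at least one edge, so #|edge| rounds suffice to reach
   the end of the game, see [play_over]. *)
Definition final_graph (W : waiter_strategy) (C : client_strategy) :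
    {set edge} :=
  client_graph (play W C #|{: edge}|).

Definition waiter_can_force (P : {set edge} -> Prop) : Prop :=
  exists2 W, legal_waiter W & forall C, legal_client C -> P (final_graph W C).

Definition client_can_ensure (P : {set edge} -> Prop) : Prop :=
  exists2 C, legal_client C & forall W, legal_waiter W -> P (final_graph W C).

Lemma play_over W C : legal_waiter W ->
  #|unoffered (play W C #|{: edge}|)| <= q.
Proof.
move=> lW.
suff H k : #|unoffered (play W C k)| <= maxn q (#|{: edge}| - k).
  by have := H #|{: edge}|; rewrite subnn maxn0.
elim: k => [|k IHk] /=.
  by rewrite subn0 leq_max max_card orbT.
case: ifP => [qlt|/negbT]; last first.
  by rewrite -leqNgt => le; rewrite leq_max le.
set h := play W C k in IHk qlt *.
have /andP[/eqP cA sA] := lW h qlt.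
have -> : unoffered ((W h, C h (W h)) :: h) = unoffered h :\: W h.
  by rewrite /unoffered /offered big_cons /= setCU setDE setIC.
move: IHk; rewrite leq_max leqNgt qlt /= => IHk.
rewrite cardsD (setIidPr sA) cA leq_max; apply/orP; right.
rewrite (leq_trans (leq_sub2r _ IHk)) // -subnDA leq_sub2l //.
by rewrite addnS ltnS leq_addr.
Qed.

End WaiterClient.

(* Main.v *)
(** (i) Whatever the players do, Client claims more than ['C(n, 2)/(q+1) - 1]
    edges, so the average degree of his graph is already [(1 - o(1)) n/(q+1)].

    (ii) For [x >= 1], put on each vertex [v] the weight [x ^ d * m ^ f], where
    [d] is the degree of [v] in Client's graph, [f] the number of unoffered edges
    at [v], and [m = 1 + (x - 1)/(q+1)].  If Client claimed a uniformly random
    offered edge, the expected weight would not increase, by Bernoulli's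
    inequality [1 + a (m - 1) <= m ^ a]; hence Client can always keep the total
    weight from increasing, and every final degree satisfies
    [x ^ d <= n m ^ n <= n exp ((x - 1) n/(q+1))].  With [N = n/(q+1)],
    [eta = ln n / N] and [x = 1 + sqrt eta] this gives
    [d <= (1 + sqrt eta)^2 N]. *)
Require Import Defs.
From mathcomp Require Import all_boot all_order all_algebra.
From mathcomp Require Import all_classical all_reals all_analysis.
From mathcomp Require Import ring lra.
Import numFieldNormedType.Exports.
Set Implicit Arguments.
Unset Strict Implicit.
Unset Printing Implicit Defensive.
Import Order.TTheory GRing.Theory Num.Theory.
Local Open Scope classical_set_scope.
Local Open Scope ring_scope.

(** * Degrees and edge counts *)

Section Degrees.
Variable n : nat.
Implicit Types (G A : {set edge n}) (e : edge n) (v : 'I_n).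

Lemma degreeE G v : degree G v = (\sum_(e in G) (v \in val e))%N.
Proof.
rewrite /degree -sum1_card big_mkcond /= [RHS]big_mkcond /=.
by apply: eq_bigr => e _; rewrite inE; case: (e \in G); case: (v \in val e).
Qed.

Lemma sum_degree G : (\sum_v degree G v = 2 * #|G|)%N.
Proof.
under eq_bigr do rewrite degreeE.
rewrite exchange_big /= mulnC -sum_nat_const; apply: eq_bigr => e _.
transitivity #|val e|; last exact/eqP/(valP e).
by rewrite -sum1_card [RHS]big_mkcond.
Qed.

Lemma card_edge : #|{: edge n}| = 'C(n, 2).
Proof. by rewrite card_sig -[in RHS](card_ord n) -card_draws cardsE. Qed.

(** Edges at [v] lie in the image of [w] under [[set v; w]]. Counting all [n] values of [w], with
    [w = v] included, costs nothing asymptotically. *)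
Lemma degree_le G v : (degree G v <= n)%N.
Proof.
rewrite /degree -(card_imset _ val_inj) -[leqRHS](card_ord n).
apply: leq_trans (leq_imset_card (fun w => [set v; w]%SET) 'I_n).
apply/subset_leq_card/fintype.subsetP => f /imsetP[e].
rewrite inE => /andP[_ ve] ->{f}.
have /cards2P[a [b [_ eab]]] : #|val e| == 2%N := valP e.
rewrite /= eab !inE in ve *; case/orP: ve => /eqP ->.
  by apply/imsetP; exists b.
by apply/imsetP; exists a => //; rewrite finset.setUC.
Qed.

Lemma degreeU1 e G v : (degree (e |: G)%SET v <= degree G v + (v \in val e))%N.
Proof.
case: (boolP (e \in G)) => eG.
  by rewrite (finset.setUidPr _) ?finset.sub1set// leq_addr.
by rewrite !degreeE big_setU1//= addnC.
Qed.

Lemma degreeD A G v : A \subset G ->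
  degree G v = (degree A v + degree (G :\: A)%SET v)%N.
Proof.
move=> AG; rewrite !degreeE (big_setID A) /=.
by rewrite (finset.setIidPr AG).
Qed.

End Degrees.

(** * Counting along a play, and Waiter's bound *)

Section Histories.
Variables n q : nat.
Implicit Types (h : history n) (A : {set edge n}) (e : edge n).

Lemma unoffered_cons A e h :
  unoffered ((A, e) :: h) = (unoffered h :\: A)%SET.
Proof.
by rewrite /unoffered /offered big_cons /= finset.setCU finset.setDE finset.setIC.
Qed.

Lemma client_graph_cons A e h :
  client_graph ((A, e) :: h) = (e |: client_graph h)%SET.
Proof. by apply/setP => f; rewrite !inE. Qed.

(** Carries an invariant along actual play, where every offer is legal and Client answers inside
    it. *)
Lemma play_ind (W : waiter_strategy n) (C : client_strategy n)
    (P : history n -> Prop) :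
  legal_waiter q W -> legal_client q C -> P [::] ->
  (forall h, P h -> legal_offer q h (W h) -> C h (W h) \in W h ->
     P ((W h, C h (W h)) :: h)) ->
  forall k, P (play q W C k).
Proof.
move=> lW lC P0 PS; elim=> [//|k IHk] /=.
by case: ifP => // /lW lo; apply: PS => //; exact: lC.
Qed.

(** Each round moves exactly [q.+1] edges out of the unoffered set and gives Client one new edge. *)
Lemma card_client_graph (W : waiter_strategy n) (C : client_strategy n) k :
  legal_waiter q W -> legal_client q C ->
  (#|client_graph (play q W C k)| * q.+1 + #|unoffered (play q W C k)|
     = 'C(n, 2))%N.
Proof.
move=> lW lC.
(* The inclusion joins the induction because it shows that the edge claimed next, being unoffered so
   far, is not yet in Client's graph. *)
suff [] : (client_graph (play q W C k) \subset offered (play q W C k)) /\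
  (#|client_graph (play q W C k)| * q.+1 + #|unoffered (play q W C k)|
     = 'C(n, 2))%N by [].
elim/play_ind: (play q W C k) => //.
  have c0 : client_graph [::] = finset.set0 :> {set edge n}.
    by apply/setP => e; rewrite !inE.
  rewrite c0 finset.sub0set cards0 mul0n add0n.
  by rewrite /unoffered /offered big_nil finset.setC0 cardsT card_edge.
move=> h [sub IH] /andP[/eqP cA sA] CA; split.
  rewrite client_graph_cons /offered big_cons finset.subUset finset.sub1set inE CA /=.
  exact: fintype.subset_trans sub (finset.subsetUr _ _).
rewrite client_graph_cons unoffered_cons cardsU1.
have -> : C h (W h) \notin client_graph h.
  have := fintype.subsetP sA _ CA; rewrite inE.
  by apply: contra; exact: (fintype.subsetP sub).
have sz : (q.+1 <= #|unoffered h|)%N by rewrite -cA subset_leq_card.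
rewrite cardsD (finset.setIidPr sA) cA -IH mulnDl mul1n.
by rewrite -addnA addnCA subnKC.
Qed.

(** Averaging: a vertex of maximum degree [d] has [2 * #|G| <= d * n], and at most [q] edges are
    left over at the end. The division by [n] is postponed by multiplying the goal by [n]. *)
Lemma exists_degree_ge (W : waiter_strategy n) (C : client_strategy n) :
  (1 < n)%N -> legal_waiter q W -> legal_client q C ->
  exists v, (n.-1 <= degree (final_graph q W C) v * q.+1 + q)%N.
Proof.
move=> n1; have n0 := ltnW n1; move=> lW lC; set G := final_graph q W C.
have [v _ vmax] := arg_maxnP (degree G) (erefl (xpredT (Ordinal n0))).
exists v.
have le_card : (2 * #|G| <= degree G v * n)%N.
  rewrite -sum_degree mulnC -[X in (X * _)%N]card_ord -sum_nat_const.
  by apply: leq_sum => w _; exact: vmax.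
have := card_client_graph #|{: edge n}| lW lC; rewrite -/(final_graph q W C) -/G.
move=> eqC; have := play_over C lW; set u := #|unoffered _| in eqC * => uq.
rewrite -(leq_pmul2l n0).
have -> : (n * n.-1 = 'C(n, 2).*2)%N.
  by rewrite bin2 -[LHS]odd_double_half oddM; case: n n0 => // m _ /=; case: odd.
rewrite -eqC doubleD mulnDr leq_add//.
  by rewrite -mul2n mulnA [leqRHS]mulnA leq_mul2r [(n * _)%N]mulnC le_card orbT.
(* The leftover [u <= q] contributes [2 * u <= n * q] since [2 <= n]. *)
by rewrite -mul2n leq_mul.
Qed.

(** The degree bound above holds for every legal play, so Waiter needs no cleverness: any [q.+1]
    unoffered edges will do. *)
Lemma legal_waiter_exists : exists W : waiter_strategy n, legal_waiter q W.
Proof.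
have /choice[W WP] : forall h, exists A,
    (q < #|unoffered h|)%N -> legal_offer q h A.
  move=> h; exists [set e in take q.+1 (enum (unoffered h))]%SET => lt.
  apply/andP; split.
    rewrite cardsE (card_uniqP _) ?take_uniq ?enum_uniq//.
    by rewrite size_takel// -cardE.
  by apply/fintype.subsetP => e; rewrite inE => /mem_take; rewrite mem_enum.
by exists W.
Qed.

End Histories.

(** * Client's potential function *)

Section Potential.
Variables (R : realFieldType) (n q : nat) (x : R).
Hypothesis x1 : 1 <= x.
Implicit Types (h : history n) (A : {set edge n}) (e : edge n).

Local Notation m := (1 + (x - 1) / q.+1%:R).

Let m1 : 1 <= m.
Proof. by rewrite lerDl divr_ge0// subr_ge0. Qed.

Lemma bernoulli (t : R) a : 0 <= t -> 1 + t * a%:R <= (1 + t) ^+ a.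
Proof.
move=> t0; elim: a => [|a IH]; first by rewrite mulr0 addr0 expr0.
rewrite exprS (le_trans _ (ler_wpM2l _ IH)) ?addr_ge0//.
have := mulr_ge0 (mulr_ge0 t0 t0) (ler0n R a).
by rewrite -natr1; lra.
Qed.

Definition weight h (v : 'I_n) : R :=
  x ^+ degree (client_graph h) v * m ^+ degree (unoffered h) v.

Definition potential h : R := \sum_v weight h v.

(** Claiming [e] multiplies the power of [x] at [v] by at most [1 + (x - 1) * (v \in val e)]. With
    [a = degree A v], these factors sum over [A] to [q.+1 * (1 + a * (m - 1))], at most
    [q.+1 * m ^+ a] by Bernoulli, and [m ^+ a] is exactly the factor that [v] loses when [A] stops
    being unoffered. *)
Lemma sum_weight_offer h A v : legal_offer q h A ->
  \sum_(e in A) weight ((A, e) :: h) v <= q.+1%:R * weight h v.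
Proof.
move=> /andP[/eqP cA sA].
pose c := x ^+ degree (client_graph h) v.
pose f := m ^+ degree (unoffered h :\: A)%SET v.
have x0 : 0 <= x := le_trans ler01 x1.
have m0 : 0 <= m := le_trans ler01 m1.
have c0 : 0 <= c by exact: exprn_ge0.
have f0 : 0 <= f by exact: exprn_ge0.
apply: (@le_trans _ _ (\sum_(e in A) (c * f) * (1 + (x - 1) * (v \in val e)%:R))).
  apply: ler_sum => e _; rewrite /weight unoffered_cons client_graph_cons -/f.
  rewrite mulrAC ler_wpM2r//.
  apply: le_trans (ler_weXn2l x1 (degreeU1 _ _ _)) _.
  rewrite exprD ler_wpM2l//.
  by case: (v \in val e); rewrite ?expr1 ?expr0 /=; lra.
rewrite -mulr_sumr big_split /= -mulr_sumr -natr_sum -degreeE sumr_const cA.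
rewrite /weight (degreeD _ sA) exprD -/c -/f.
rewrite [leRHS]mulrCA [q.+1%:R * _]mulrA [_ * _ * f]mulrC [leRHS]mulrA.
rewrite ler_wpM2l ?mulr_ge0//.
have := @bernoulli ((x - 1) / q.+1%:R) (degree A v).
rewrite divr_ge0 ?subr_ge0// => /(_ isT).
move=> /(ler_wpM2l (ler0n R q.+1)).
by rewrite mulrDr mulr1 mulrA [q.+1%:R * (_ / _)]mulrC divfK ?pnatr_eq0.
Qed.

(** If every edge of [A] raised the potential, the sum over the [q.+1] choices would exceed [q.+1]
    times the old potential, against [sum_weight_offer] summed over [v]. *)
Lemma exists_good_edge h A : legal_offer q h A ->
  exists2 e, e \in A & potential ((A, e) :: h) <= potential h.
Proof.
move=> lo; apply: contrapT => none.
have lt e : e \in A -> potential h < potential ((A, e) :: h).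
  by move=> eA; rewrite ltNge; apply/negP => le; apply: none; exists e.
have [/eqP cA _] := andP lo.
have : \sum_(e in A) potential ((A, e) :: h) <= q.+1%:R * potential h.
  rewrite exchange_big mulr_sumr; apply: ler_sum => v _.
  exact: sum_weight_offer.
rewrite leNgt => /negP; apply.
rewrite mulr_natl -cA -sumr_const; apply: ltr_sum.
  have /card_gt0P[e eA] : (0 < #|A|)%N by rewrite cA.
  by apply/hasP; exists e; rewrite ?mem_index_enum.
exact: lt.
Qed.

Lemma potential_strategy : (1 < n)%N ->
  exists2 C : client_strategy n, legal_client q C &
    forall W, legal_waiter q W ->
      forall k, potential (play q W C k) <= potential [::].
Proof.
move=> n1.
(* Default answer to illegal offers; an edge exists because [1 < n]. *)
have e0 : edge n.
  have /card_gt0P/cid[e _] : (0 < #|{: edge n}|)%N by rewrite card_edge bin_gt0.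
  exact: e.
have /choice[C CP] : forall hA : history n * {set edge n}, exists e,
    legal_offer q hA.1 hA.2 ->
    e \in hA.2 /\ potential ((hA.2, e) :: hA.1) <= potential hA.1.
  move=> [h A] /=; have [lo|nlo] := boolP (legal_offer q h A); last by exists e0.
  by have [e eA le] := exists_good_edge lo; exists e.
have lC : legal_client q (fun h A => C (h, A)).
  by move=> h A lo; have [] := CP (h, A) lo.
exists (fun h A => C (h, A)) => // W lW k.
elim/play_ind: (play q W _ k) => // h IH lo _.
by apply: le_trans IH; have [] := CP (h, W h) lo.
Qed.

Lemma potential_nil : potential [::] <= n%:R * m ^+ n.
Proof.
rewrite mulr_natl -[X in _ *+ X]card_ord -sumr_const; apply: ler_sum => v _.
rewrite /weight (_ : degree (client_graph [::]) v = 0%N); last first.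
  by apply/eqP; rewrite cards_eq0; apply/eqP/setP => e; rewrite !inE.
by rewrite expr0 mul1r; apply: ler_weXn2l; [exact: m1 | exact: degree_le].
Qed.

Lemma potential_ge h v : x ^+ degree (client_graph h) v <= potential h.
Proof.
have w0 u : 0 <= weight h u.
  by rewrite mulr_ge0// exprn_ge0// (le_trans ler01).
rewrite /potential (bigD1 v)//= ler_wpDr ?sumr_ge0//.
by rewrite ler_peMr ?exprn_ege1// exprn_ge0// (le_trans ler01).
Qed.

End Potential.

(** * From the potential to a degree bound *)

Section Bounds.
Variable R : realType.

Lemma ln_ge_1BV (x : R) : 0 < x -> 1 - x^-1 <= ln x.
Proof.
move=> x0; have := @le_ln1Dx R (x^-1 - 1).
rewrite addrCA subrr addr0 lnV// ltrBrDr addrC subrr invr_gt0 => /(_ x0).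
lra.
Qed.

(** Take [x = 1 + s], bound [m] by [expR (s / q.+1)], and compare logarithms using
    [ln (1 + s) >= s / (1 + s)]. The parameter [s] is left free, to be optimised later. *)
Lemma client_degree_bound (n q : nat) (s : R) : (1 < n)%N -> 0 < s ->
  client_can_ensure q (fun G : {set edge n} => forall v,
    (degree G v)%:R <=
      (1 + s) * (ln n%:R / s + n%:R / q.+1%:R)).
Proof.
move=> n1 s0; have x1 : 1 <= 1 + s by lra.
have [C lC CP] := potential_strategy q x1 n1.
exists C => // W lW v; set d := degree _ v.
have x0 : 0 < 1 + s by lra.
have n0 : 0 < n%:R :> R by rewrite ltr0n ltnW.
have : (1 + s) ^+ d <= n%:R * expR (s * (n%:R / q.+1%:R)).
  apply: le_trans (potential_ge q x1 _ v) _.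
  apply: le_trans (CP W lW _) _; apply: le_trans (potential_nil n q x1) _.
  rewrite ler_wpM2l ?ler0n// addrAC subrr add0r.
  rewrite mulrCA expRM_natl lerXn2r ?nnegrE ?expR_ge0 ?expR_ge1Dx//.
  by rewrite addr_ge0// divr_ge0// ltW.
rewrite -ler_ln ?posrE ?exprn_gt0 ?mulr_gt0 ?expR_gt0//.
rewrite lnXn// lnM ?posrE ?expR_gt0// expRK -[leLHS]mulr_natl => le.
have {le} : d%:R * (1 - (1 + s)^-1) <= ln n%:R + s * (n%:R / q.+1%:R).
  by apply: le_trans le; rewrite ler_wpM2l ?ler0n// ln_ge_1BV.
have -> : 1 - (1 + s)^-1 = s / (1 + s) by field; rewrite gt_eqF.
rewrite mulrA ler_pdivrMr// -(ler_pM2r (_ : 0 < s^-1)) ?invr_gt0//.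
rewrite mulfK ?gt_eqF// => /le_trans; apply; rewrite le_eqVlt; apply/orP; left.
by apply/eqP; field; rewrite !gt_eqF// ltr0Sn.
Qed.

End Bounds.

Theorem theorem1p5 (R : realType) (q : nat -> nat)
    (q_gt0 : forall n : nat, (0 < q n)%N)
    (q_small : (fun n : nat => (q n)%:R : R^o)
                 =o_\oo (fun n : nat => n%:R / ln n%:R : R^o)) :
  exists eps1 eps2 : nat -> R,
    [/\ eps1 n @[n --> \oo] --> (0 : R),
        eps2 n @[n --> \oo] --> (0 : R) &
        forall n : nat, (2 <= n)%N ->
          waiter_can_force (q n) (fun G : {set edge n} =>
            exists v : 'I_n,
              (1 + eps1 n) * (n%:R / (q n).+1%:R) <= (degree G v)%:R)
          /\
          client_can_ensure (q n) (fun G : {set edge n} =>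
            forall v : 'I_n,
              (degree G v)%:R <= (1 + eps2 n) * (n%:R / (q n).+1%:R))].
Proof.
pose eta n : R := (q n).+1%:R * ln n%:R / n%:R.
(* Besides positivity, this gives [1 <= 2 * ln n], which absorbs the additive loss of 1 in Waiter's
   bound. *)
have ln_gt n : (2 <= n)%N -> 2^-1 <= ln (n%:R : R).
  move=> n2; have n2R : 2 <= n%:R :> R by rewrite ler_nat.
  apply: le_trans (ln_ge_1BV _); last lra.
  have : n%:R^-1 <= 2^-1 :> R by rewrite lef_pV2// posrE; lra.
  lra.
have eta0 : eta n @[n --> \oo] --> (0 : R).
  apply/cvgrPdist_le => e e0.
  move/eqoP : q_small => /(_ (e / 2)); rewrite divr_gt0// => /(_ isT) near_q.
  near=> n.
  have n2 : (2 <= n)%N by near: n; exists 2%N.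
  have ln0 : 0 < ln (n%:R : R) by have := ln_gt n n2; lra.
  have n0 : 0 < n%:R :> R by rewrite ltr0n ltnW.
  have : `|(q n)%:R : R| <= e / 2 * `|n%:R / ln n%:R : R| by near: n.
  rewrite ger0_norm ?ler0n// ger0_norm ?divr_ge0 ?(ltW n0) ?(ltW ln0)//.
  rewrite mulrA ler_pdivlMr// => le_q.
  rewrite sub0r normrN ger0_norm /eta; last by rewrite divr_ge0 ?mulr_ge0// ltW.
  rewrite ler_pdivrMr//.
  (* Positivity of [q n] enters here; the factor 2 is why smallness was requested with [e / 2]. *)
  have : (q n).+1%:R <= 2 * (q n)%:R :> R.
    by rewrite -natrM ler_nat mul2n -addnn -addn1 leq_add2l.
  move=> /(ler_wpM2r (ltW ln0)); lra.
(* As [eta n * (n / q.+1) = ln n], the first choice lowers the target by [2 * ln n]. The second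
   comes from expanding [(1 + s) ^+ 2] with [s] the square root of [eta n]. *)
exists (fun n => - (2 * eta n)), (fun n => 2 * Num.sqrt (eta n) + eta n).
split.
- rewrite -oppr0 -[X in - X](mulr0 2).
  by apply: cvgN; apply: cvgM => //; exact: cvg_cst.
- have sqrt0 : Num.sqrt (eta n) @[n --> \oo] --> (0 : R).
    by rewrite -[X in _ --> X](@sqrtr0 R); apply: continuous_cvg => //;
      exact: sqrt_continuous.
  rewrite -[X in _ --> X](addr0 0) -[X in X + _](mulr0 2).
  by apply: cvgD => //; apply: cvgM => //; exact: cvg_cst.
move=> n n2.
have n0 : 0 < n%:R :> R by rewrite ltr0n ltnW.
have q0 : 0 < (q n).+1%:R :> R by [].
have lnn := ln_gt n n2.
split.
  have [W lW] := legal_waiter_exists n (q n).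
  exists W => // C lC.
  have [v] := exists_degree_ge n2 lW lC.
  set d := degree _ v => le_d; exists v; rewrite -/d.
  have {le_d} : n%:R <= d%:R * (q n).+1%:R + (q n).+1%:R :> R.
    by rewrite -natrM -natrD ler_nat (leq_trans (leqSpred n))// addnS ltnS.
  have -> : (1 + - (2 * eta n)) * (n%:R / (q n).+1%:R)
      = n%:R / (q n).+1%:R - 2 * ln n%:R.
    by rewrite /eta; field; rewrite !gt_eqF.
  move=> le_d; rewrite lerBlDr ler_pdivrMr// (le_trans le_d)//.
  by rewrite mulrDl lerD2l ler_peMl ?(ltW q0)//; lra.
set s := Num.sqrt (eta n).
have eta_gt0 : 0 < eta n by rewrite divr_gt0 ?mulr_gt0//; lra.
have s0 : 0 < s by rewrite sqrtr_gt0.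
have [C lC CP] := client_degree_bound (q n) n2 s0.
exists C => // W lW v; apply: le_trans (CP W lW v) _.
(* This choice of [s] balances the bound: [ln n / s] becomes [s * (n / q.+1)], so a second factor
   [1 + s] appears. *)
have lnE : ln n%:R = s ^+ 2 * (n%:R / (q n).+1%:R).
  rewrite sqr_sqrtr ?(ltW eta_gt0)// /eta.
  by field; rewrite !gt_eqF.
rewrite lnE -[in leRHS](sqr_sqrtr (ltW eta_gt0)) -/s le_eqVlt; apply/orP; left.
by apply/eqP; field; rewrite !gt_eqF.
Unshelve. all: by end_near.
Qed.
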